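(* If $\mathcal I$ is a Fubini ideal on a compact space $K$, then for any Polish group $X$ the semi-ideal $\mathcal{HI}$ of Haar-$\mathcal I$ sets in $X$ is an ideal.
   Context: All groups are Abelian, written additively; a Polish group is a topological group whose underlying space is Polish. A semi-ideal on a set is a nonempty family of subsets closed under taking subsets; an ideal is a semi-ideal $\mathcal J$ such that for any $A,B\in\mathcal J$ there is $C\in\mathcal J$ with $A\cup B\subset C$ (equivalently $A\cup B\in\mathcal J$). Semi-ideals used to define Haar-$\mathcal I$ sets are assumed to satisfy $\bigcup\mathcal I=K\neq\emptyset$. A subset $A$ of a topological group $X$ is Haar-$\mathcal I$ if there exists a continuous map $f:K\to X$ such that $f^{-1}(A+x)\in\mathcal I$ for all $x\in X$. For a Polish group $X$, $\mathcal{HI}$ is the family of all subsets of Borel Haar-$\mathcal I$ sets in $X$. Fubini families: let $K$ be a topological space, $1\le n\le\omega$ and $i\in n=\{0,\dots,n-1\}$ (with $n=\omega=\{0,1,\dots\}$ allowed). For $a\in K^{n\setminus\{i\}}$ let $e_a:K\to K^n$ be the embedding sending $x\in K$ to the function $y:n\to K$ with $y(i)=x$ and $y|_{n\setminus\{i\}}=a$. For a family $\mathcal I$ of subsets of $K$ put $\mathcal I^n_i=\{A\subset K^n:\forall a\in K^{n\setminus\{i\}}\;\; e_a^{-1}(A)\in\mathcal I\}$. The family $\mathcal I$ is $n$-Fubini if there is a continuous map $h:K\to K^n$ such that for any $i\in n$ and any Borel set $B\subset K^n$ with $B\in\mathcal I^n_i$ we have $h^{-1}(B)\in\mathcal I$.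 The family $\mathcal I$ is called Fubini if it is $2$-Fubini (equivalently, $n$-Fubini for some $n$ with $2\le n\le\omega$; equivalently, $n$-Fubini for every such $n$). *)

(* Defs.v *)
From HB Require Import structures.
From mathcomp Require Import all_boot all_order all_algebra.
From mathcomp Require Import all_classical all_reals all_analysis.

Set Implicit Arguments.
Unset Strict Implicit.
Unset Printing Implicit Defensive.

Import Order.TTheory GRing.Theory Num.Theory.
Local Open Scope classical_set_scope.
Local Open Scope ring_scope.

Definition semi_ideal {T : Type} (J : set (set T)) : Prop :=
  J !=set0 /\ (forall A B : set T, J B -> A `<=` B -> J A).

Definition ideal {T : Type} (J : set (set T)) : Prop :=
  semi_ideal J /\
  (forall A B : set T, J A -> J B -> exists2 C, J C & A `|` B `<=` C).

Definition borel {T : topologicalType} : set (set T) := <<s @open T >>.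

Definition separable (T : topologicalType) : Prop :=
  exists2 D : set T, countable D & dense D.

Definition homeomorphic (T U : topologicalType) : Prop :=
  exists (f : T -> U) (g : U -> T),
    [/\ cancel f g, cancel g f, continuous f & continuous g].

Definition complete_metric {R : realType} (M : metricType R) : Prop :=
  forall F : set_system M, ProperFilter F -> cauchy F -> exists l : M, F --> l.

(* [R] is only the type of values of the metric. *)
Definition polish (R : realType) (T : topologicalType) : Prop :=
  separable T /\
  exists2 M : metricType R, complete_metric M & homeomorphic T M.

Section Fubini.
Context {K : topologicalType} {J : eqType}.

(* [a] is a point of K^(J \ {i}); since [insub j] is [None] exactly when
   [j = i], this is the point of K^J with i-th coordinate [x] and the other
   coordinates given by [a]. *)
Definition fubini_embed (i : J) (a : {j : J | j != i} -> K) (x : K) : J -> K :=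
  fun j => oapp a x (insub j).

Definition fubini_slices (I : set (set K)) (i : J) : set (set (J -> K)) :=
  [set A | forall a : {j : J | j != i} -> K, I (fubini_embed a @^-1` A)].

End Fubini.

(* n-Fubini for finite n is [J := 'I_n], and omega-Fubini is [J := nat];
   [{ptws J -> K}] is K^J with the product topology. *)
Definition index_fubini (J : eqType) {K : topologicalType} (I : set (set K))
    : Prop :=
  exists2 h : K -> {ptws J -> K}, continuous h &
    forall (i : J) (B : set {ptws J -> K}),
      borel B -> fubini_slices I i B -> I (h @^-1` B).

Definition fubini {K : topologicalType} (I : set (set K)) : Prop :=
  index_fubini 'I_2 I.

Section Haar.
Context {K : topologicalType} (I : set (set K)) {X : topologicalZmodType}.

Definition haar (A : set X) : Prop :=
  exists2 f : K -> X, continuous f &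
    forall x : X, I (f @^-1` [set a + x | a in A]).

Definition haar_sets : set (set X) :=
  [set A | exists B : set X, [/\ borel B, haar B & A `<=` B]].

End Haar.

(* Main.v *)
Require Import Defs.
From mathcomp Require Import all_boot all_order all_algebra.
From mathcomp Require Import all_classical all_reals all_analysis.

(** The idea is to find one continuous map that witnesses the smallness of two
    Haar-[I] sets at the same time.  Let [f0, f1 : K -> X] witness that [A0] and
    [A1] are Haar-[I], and consider [s y = f0 (y 0) + f1 (y 1)] on the square
    of [K].  Freezing one coordinate of [y] turns [s] into a translate of
    [f0] or of [f1]; since being a Haar-[I] witness is a condition on all
    translates, the preimage under [s] of a translate of [A0] has all its
    slices in direction [0] in [I], and likewise for [A1] in direction [1].
    These preimages are Borel, so if [h] is the continuous map given by the
    Fubini property, then [s \o h] is a witness for [A0] and for [A1]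
    ([fubini_common_witness]).  As [I] is an ideal, it is also one for
    [A0 `|` A1].  The argument is carried out for an arbitrary finite index
    set, which treats both coordinates by the same computation. *)

Import GRing.Theory.
Local Open Scope ring_scope.
Local Open Scope classical_set_scope.

Lemma borel_set0 (T : topologicalType) : borel (set0 : set T).
Proof. exact: sigma_algebra0. Qed.

Lemma borel_setU (T : topologicalType) (A B : set T) :
  borel A -> borel B -> borel (A `|` B).
Proof.
move=> bA bB; rewrite -bigcup2E; apply: sigma_algebra_bigcup => -[|[|n]] //=.
exact: borel_set0.
Qed.

Lemma borel_preimage (S T : topologicalType) (f : S -> T) (B : set T) :
  continuous f -> borel B -> borel (f @^-1` B).
Proof.
move=> cf bB.
(* The sets with Borel preimage form a sigma-algebra, the image of the Borel
   one under [f]. *)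
have : image_set_system [set: S] f (@borel S) B.
  apply: (smallest_sub _ _ bB).
    exact/sigma_algebra_image/smallest_sigma_algebra.
  move=> U oU; rewrite /image_set_system /= setTI; apply: sub_sigma_algebra.
  by move: U oU; apply/continuousP.
by rewrite /image_set_system /= setTI.
Qed.

Lemma translateE (X : zmodType) (A : set X) (x : X) :
  [set a + x | a in A] = (fun y => y - x) @^-1` A.
Proof.
apply/seteqP; split=> [_ [a Aa <-]|y Ay] /=; first by rewrite addrK.
by exists (y - x) => //; rewrite subrK.
Qed.

Lemma borel_translate (X : topologicalZmodType) (A : set X) (x : X) :
  borel A -> borel [set a + x | a in A].
Proof.
move=> bA; rewrite translateE; apply: borel_preimage bA => y.
apply: (@continuous2_cvg _ _ _ _ (nbhs y) _ id (cst (- x)) +%R).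
- exact: (@add_continuous X (y, - x)).
- exact: cvg_id.
- exact: cvg_cst.
Qed.

Section CoordinateSum.
Context {K : topologicalType} {X : topologicalZmodType} {J : finType}.
Implicit Type f : J -> K -> X.

Definition coordinate_sum f (y : {ptws J -> K}) : X := \sum_j f j (y j).

Lemma coordinate_sum_continuous f :
  (forall j, continuous (f j)) -> continuous (coordinate_sum f).
Proof.
move=> cf y; apply: (@cvg_big X J +%R 0 predT _ _ (nbhs y)) => [|j _].
  exact: add_continuous.
have cproj : {for y, continuous (fun z : {ptws J -> K} => z j)}.
  exact: (@proj_continuous J (fun=> K) j y).
exact: continuous_comp cproj (cf j (y j)).
Qed.

Lemma coordinate_sum_embed f (i : J) (a : {j : J | j != i} -> K) :
  exists c, forall x, coordinate_sum f (fubini_embed a x) = f i x + c.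
Proof.
(* The frozen coordinates contribute the constant; [a] is defined only off [i],
   so the summand is written through [insub], as in [fubini_embed], and the
   default value is never reached. *)
exists (\sum_(j | j != i) oapp (fun k => f (val k) (a k)) 0 (insub j)) => x.
rewrite /coordinate_sum (bigD1 i) //= /fubini_embed insubN ?eqxx //=.
by congr (_ + _); apply: eq_bigr => j ij; rewrite insubT.
Qed.

(** The constant [c] contributed by the frozen coordinates is absorbed by
    translating [A] by [x - c]: this is where it matters that a Haar witness
    controls every translate of [A]. *)
Lemma coordinate_sum_slices (I : set (set K)) f (i : J) (A : set X) :
  (forall x, I (f i @^-1` [set a + x | a in A])) ->
  forall x, fubini_slices I i (coordinate_sum f @^-1` [set a + x | a in A]).
Proof.
move=> IA x a; have [c fc] := coordinate_sum_embed f i a.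
rewrite (_ : _ @^-1` _ = f i @^-1` [set b + (x - c) | b in A]) //.
rewrite !translateE; apply/seteqP.
by split=> t /=; rewrite fc opprB addrA.
Qed.

(** Pulling the coordinate sum of the individual witnesses back along the
    Fubini map gives a witness for all the sets at once. *)
Lemma fubini_common_witness (I : set (set K)) (A : J -> set X) :
  index_fubini J I -> (forall j, borel (A j)) -> (forall j, haar I (A j)) ->
  exists2 f : K -> X, continuous f &
    forall j x, I (f @^-1` [set a + x | a in A j]).
Proof.
move=> [h ch hI] bA hA.
have [j|f fA] := @choice J (K -> X) (fun j g => continuous g /\
    forall x, I (g @^-1` [set a + x | a in A j])).
  by have [g cg gA] := hA j; exists g.
have cs : continuous (coordinate_sum f).
  by apply: coordinate_sum_continuous => j; have [] := fA j.
exists (coordinate_sum f \o h).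
  by move=> t; apply: continuous_comp; [exact: ch|exact: cs].
move=> j x; rewrite comp_preimage; apply: (hI j).
  by apply: borel_preimage cs _; exact: borel_translate.
by apply: coordinate_sum_slices; have [] := fA j.
Qed.

End CoordinateSum.

Section HaarSets.
Context {K : topologicalType} {I : set (set K)} {X : topologicalZmodType}.

Lemma ideal_setU (A B : set K) : ideal I -> I A -> I B -> I (A `|` B).
Proof.
move=> [[_ subI] UI] IA IB; have [C IC] := UI A B IA IB.
exact: subI.
Qed.

Lemma haar_set0 : semi_ideal I -> @haar K I X set0.
Proof.
move=> [[A IA] subI]; exists (cst 0) => [|x]; first exact: cst_continuous.
by rewrite image_set0 preimage_set0; apply: subI IA _.
Qed.

Lemma haar_setU (A B : set X) : ideal I -> fubini I ->
  borel A -> borel B -> haar I A -> haar I B -> haar I (A `|` B).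
Proof.
move=> idI fubI bA bB hA hB.
pose AB (j : 'I_2) := if j == ord0 then A else B.
have [j|j|f cf fAB] := @fubini_common_witness _ X _ I AB fubI.
- by rewrite /AB; case: ifP.
- by rewrite /AB; case: ifP.
exists f => // x; rewrite image_setU preimage_setU.
by apply: ideal_setU => //; [exact: (fAB ord0)|exact: (fAB ord_max)].
Qed.

Lemma haar_sets_semi_ideal : semi_ideal I -> semi_ideal (@haar_sets K I X).
Proof.
move=> sI; split=> [|A B [C [bC hC BC]] AB].
  exists set0, set0; split=> //; [exact: borel_set0|exact: haar_set0].
by exists C; split=> //; apply: subset_trans BC.
Qed.

End HaarSets.

Theorem theorem12p3 (R : realType) (K : topologicalType)
    (K_neq0 : [set: K] !=set0) (K_compact : compact [set: K])
    (I : set (set K)) (I_ideal : ideal I)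
    (I_cover : \bigcup_(A in I) A = [set: K]) (I_fubini : fubini I)
    (X : topologicalZmodType) (X_polish : polish R X) :
  ideal (@haar_sets K I X).
Proof.
split; first by apply: haar_sets_semi_ideal; case: I_ideal.
move=> A B [A' [bA' hA' AA']] [B' [bB' hB' BB']].
exists (A' `|` B'); last exact: setUSS.
by exists (A' `|` B'); split=> //; [exact: borel_setU|exact: haar_setU].
Qed.
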